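(* Let $\mathcal{S}$ be a linear subdivision scheme with symbol $$a(z)=z^{-s}(1+z)\left(\prod_{i=1}^{m_1}\frac{1+\alpha_iz}{1+\alpha_i}\right)\frac{1+2\operatorname{Re}(\alpha_{m_1+1})z+|\alpha_{m_1+1}|^2z^2}{1+2\operatorname{Re}(\alpha_{m_1+1})+|\alpha_{m_1+1}|^2},$$ where $s\in\mathbb{Z}$, $m_1\ge1$, $\alpha_i>0$ for $1\le i\le m_1$, and $\alpha_{m_1+1}\in\mathbb{C}\setminus\mathbb{R}$. Let $$\mu_1=\min_{1\le i\le m_1}\max\Big\{\frac{1}{1+\alpha_i},\frac{\alpha_i}{1+\alpha_i}\Big\},$$ with the linear factors numbered so that $\mu_1$ is attained at $\alpha_1$. Let $\upsilon=\arccos\big(\frac{3\mu_1-1}{1+\mu_1}\big)$, so that $0<\upsilon\le\arccos(\frac13)$, and let $$\rho_{1,2}(\phi)=\frac{-(1+\mu_1)}{1-\mu_1}\cos(\phi)+\frac{2\mu_1}{1-\mu_1}\mp\sqrt{\left(\frac{-(1+\mu_1)}{1-\mu_1}\cos(\phi)+\frac{2\mu_1}{1-\mu_1}\right)^2-1},$$ where $\rho_1$ corresponds to the sign $-$ and $\rho_2$ to the sign $+$. Define $$\Omega=\left\{re^{i\phi}\ \middle|\ \rho_1(\phi)\le r\le\rho_2(\phi),\ \upsilon<\phi<2\pi-\upsilon\right\}\cup\left\{e^{i\upsilon},e^{-i\upsilon}\right\}.$$ Then the adaptation $\widetilde{\mathcal{S}}$ of $\mathcal{S}$ to manifold data based on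 the general global refinement step (described in the context) converges from all admissible input data whenever $\alpha_{m_1+1}$ is outside $\Omega$.
   Context: Linear scheme and symbol: a linear subdivision scheme has a refinement rule $\mathcal{S}(\mathbf{f})_j=\sum_{i\in\mathbb{Z}}a_{j-2i}f_i$ with finitely supported real mask $(a_i)_{i\in\mathbb{Z}}$; its symbol is $a(z)=\sum_{i}a_iz^i$. Geodesic averages: $\mathcal{M}$ is a complete connected Riemannian manifold with Riemannian distance $d$. For $p_1,p_2\in\mathcal{M}$, $t\mapsto M_t(p_1,p_2)$, $t\in[0,1]$, is the (canonically chosen, if not unique) shortest geodesic, parametrized with constant speed, with $M_0(p_1,p_2)=p_1$, $M_1(p_1,p_2)=p_2$. For the values $t\notin[0,1]$ that are used, $M_t(p_1,p_2)$ is assumed to be well-defined as a point on the continuation of this geodesic (same constant-speed parametrization), and $d(M_t(p_1,p_2),p_2)=|1-t|\,d(p_1,p_2)$, $d(p_1,M_t(p_1,p_2))=|t|\,d(p_1,p_2)$ for all $t$ used. A data sequence $\mathbf{p}=(p_i)_{i\in\mathbb{Z}}$ in $\mathcal{M}$ is admissible if the geodesic curve between any two adjacent points is well-defined; all geodesic averages occurring in the repeated refinement are assumed well-defined. Put $\delta(\mathbf{p})=\sup_{i\in\mathbb{Z}}d(p_i,p_{i+1})$; data are understood to satisfy $\delta(\mathbf{p})<\infty$. Three pyramid: for a non-real $\alpha$ put $D=1+2\operatorname{Re}(\alpha)+|\alpha|^2$, $w_1=\frac1D$, $w_2=\frac{2\operatorname{Re}(\alpha)}{D}$, $w_3=\frac{|\alpha|^2}{D}$.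 The three pyramid average of $p_1,p_2,p_3\in\mathcal{M}$ is $$\mathcal{P}\big((p_1,p_2,p_3),(w_1,w_2,w_3)\big)=M_r\big(M_{t_2}(p_3,p_2),M_{t_1}(p_2,p_1)\big)$$ with the parameters $r=\frac{1}{1+|\alpha|}$, $t_1=\frac{w_1}{r}=\frac{1+|\alpha|}{D}$, $t_2=1-\frac{w_3}{1-r}=\frac{1+2\operatorname{Re}(\alpha)-|\alpha|}{D}$. General global refinement step $\mathbf{p}\mapsto\widetilde{\mathcal{S}}(\mathbf{p})$ (here with one quadratic factor): set $q_{2i,0}=q_{2i+1,0}=p_i$ for $i\in\mathbb{Z}$; for $j=1,\dots,m_1$ successively set $q_{i,j}=M_{\frac{\alpha_j}{1+\alpha_j}}(q_{i,j-1},q_{i+1,j-1})$ for all $i$; then set $q_{i,m_1+1}=\mathcal{P}\big((q_{i,m_1},q_{i+1,m_1},q_{i+2,m_1}),(w_1,w_2,w_3)\big)$ for all $i$, with weights and parameters determined by $\alpha=\alpha_{m_1+1}$; finally set $\widetilde{\mathcal{S}}(\mathbf{p})_{i-s+1}=q_{i,m_1+1}$ for all $i$. The subdivision scheme is the repeated application of this step. Convergence: for $k\ge 0$ let $I(\widetilde{\mathcal{S}}^k(\mathbf{p})):\mathbb{R}\to\mathcal{M}$ be the piecewise geodesic interpolant that takes the value $\widetilde{\mathcal{S}}^k(\mathbf{p})_i$ at $i2^{-k}$ and, on $[i2^{-k},(i+1)2^{-k}]$, follows (with constant speed) the geodesic curve connecting $\widetilde{\mathcal{S}}^k(\mathbf{p})_i$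 and $\widetilde{\mathcal{S}}^k(\mathbf{p})_{i+1}$. The scheme converges from $\mathbf{p}$ if the sequence $I(\widetilde{\mathcal{S}}^k(\mathbf{p}))$, $k\in\mathbb{Z}_+$, converges uniformly with respect to $d$. *)

(* Defs.v *)
From HB Require Import structures.
From mathcomp Require Import all_boot all_order all_algebra.
From mathcomp Require Import complex.
From mathcomp Require Import all_classical all_reals all_analysis.

Set Implicit Arguments.
Unset Strict Implicit.
Unset Printing Implicit Defensive.

Import Order.TTheory GRing.Theory Num.Theory.
Import numFieldNormedType.Exports.

Local Open Scope classical_set_scope.
Local Open Scope ring_scope.

(** * Smooth Riemannian manifolds *)

(* On an open set U, existence and continuity on U of all iterated directional
   derivatives up to order k characterizes C^k. *)
Fixpoint Ck_on (R : realType) (n : nat) (W : normedModType R) (k : nat)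
    (U : set 'rV[R]_n) (f : 'rV[R]_n -> W) : Prop :=
  match k with
  | 0 => {within U, continuous f}
  | k'.+1 => forall v : 'rV[R]_n,
      (forall x, U x -> derivable f x v) /\ Ck_on k' U (fun x => 'D_v f x)
  end.

Definition smooth_on (R : realType) (n : nat) (W : normedModType R)
    (U : set 'rV[R]_n) (f : 'rV[R]_n -> W) : Prop :=
  forall k, Ck_on k U f.

Definition quad_form (R : realType) (n : nat) (G : 'M[R]_n) (v : 'rV[R]_n) : R :=
  (v *m G *m v^T) 0 0.

(* Charts are total functions, meaningful on chart_dom only; likewise chart_inv
   and metric are meaningful on the image chart_img of a chart only.
   metric c x is the Gram matrix of the metric tensor in the coordinates of c. *)
Record riemannian_manifold (R : realType) (n : nat) := RiemannianManifold {
  space :> topologicalType;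
  space_hausdorff : hausdorff_space space;
  space_second_countable : @second_countable space;
  chart_index : Type;
  chart_dom : chart_index -> set space;
  chart : chart_index -> space -> 'rV[R]_n;
  chart_inv : chart_index -> 'rV[R]_n -> space;
  chart_img := fun c => chart c @` chart_dom c;
  chart_cover : forall p, exists c, chart_dom c p;
  chart_dom_open : forall c, open (chart_dom c);
  chart_img_open : forall c, open (chart_img c);
  chartK : forall c p, chart_dom c p -> chart_inv c (chart c p) = p;
  chart_continuous : forall c, {within chart_dom c, continuous (chart c)};
  chart_inv_continuous : forall c, {within chart_img c, continuous (chart_inv c)};
  transition_smooth : forall c c',
    smooth_on (chart c @` (chart_dom c `&` chart_dom c'))
      (chart c' \o chart_inv c);
  metric : chart_index -> 'rV[R]_n -> 'M[R]_n;
  metric_sym : forall c x, chart_img c x -> (metric c x)^T = metric c x;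
  metric_pos : forall c x v, chart_img c x -> v != 0 ->
    0 < quad_form (metric c x) v;
  metric_smooth : forall c i j,
    smooth_on (chart_img c) (fun x => metric c x i j : R^o);
  metric_transition : forall c c' p v, chart_dom c p -> chart_dom c' p ->
    quad_form (metric c (chart c p)) v =
    quad_form (metric c' (chart c' p))
      ('D_v (chart c' \o chart_inv c) (chart c p))
}.

Definition speed (R : realType) (n : nat) (M : riemannian_manifold R n)
    (c : chart_index M) (x : R -> 'rV[R]_n) (t : R) : R :=
  Num.sqrt (quad_form (metric c (x t)) (derive1 x t)).

(* path_length p q L: some piecewise C^1 curve from p to q has length L.  The
   curve is cut into finitely many C^1 pieces, each inside a single chart c and
   given there by coordinates x : [a, b] -> chart_img c. *)
Inductive path_length (R : realType) (n : nat) (M : riemannian_manifold R n) :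
    M -> M -> R -> Prop :=
| path_length_nil (p : M) : path_length p p 0
| path_length_cons (c : chart_index M) (x : R -> 'rV[R]_n) (a b : R)
    (q : M) (L : R) :
    a <= b ->
    (forall t, t \in `[a, b] -> chart_img c (x t)) ->
    (forall t, t \in `[a, b] -> derivable x t 1) ->
    {within `[a, b], continuous (derive1 x)} ->
    path_length (chart_inv c (x b)) q L ->
    path_length (chart_inv c (x a)) q
      ((\int[lebesgue_measure]_(t in `[a, b]) speed c x t) + L).

Definition dist (R : realType) (n : nat) (M : riemannian_manifold R n)
    (p q : M) : R :=
  inf [set L | path_length p q L].

Definition metrically_complete (R : realType) (n : nat)
    (M : riemannian_manifold R n) : Prop :=
  forall u : nat -> M,
    (forall e : R, 0 < e ->
       exists N, forall k l, (N <= k)%N -> (N <= l)%N -> dist (u k) (u l) < e) ->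
    exists p : M, forall e : R, 0 < e ->
      exists N, forall k, (N <= k)%N -> dist (u k) p < e.

(** * Geodesics *)

(* Partial derivative, at x, of the (i, j) entry of the metric in the direction
   of the l-th coordinate. *)
Definition dmetric (R : realType) (n : nat) (M : riemannian_manifold R n)
    (c : chart_index M) (x : 'rV[R]_n) (l i j : 'I_n) : R :=
  'D_(delta_mx 0 l) (fun y => metric c y i j : R^o) x.

Definition christoffel (R : realType) (n : nat) (M : riemannian_manifold R n)
    (c : chart_index M) (x : 'rV[R]_n) (k i j : 'I_n) : R :=
  2^-1 * \sum_(l < n) invmx (metric c x) k l *
    (dmetric c x i j l + dmetric c x j i l - dmetric c x l i j).

Definition geodesic (R : realType) (n : nat) (M : riemannian_manifold R n)
    (g : R -> M) : Prop :=
  continuous g /\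
  forall (t : R) (c : chart_index M), chart_dom c (g t) ->
    let x := chart c \o g in
    [/\ \forall s \near t, derivable x s 1,
        derivable (derive1 x) t 1 &
        forall k, derive1 (derive1 x) t 0 k +
          \sum_(i < n) \sum_(j < n)
            christoffel c (x t) k i j * derive1 x t 0 i * derive1 x t 0 j = 0].

Definition constant_speed (R : realType) (n : nat) (M : riemannian_manifold R n)
    (g : R -> M) (v : R) : Prop :=
  forall (t : R) (c : chart_index M), chart_dom c (g t) ->
    speed c (chart c \o g) t = v.

(* The length over [0, 1] of a curve of constant speed v is v; it is shortest
   when v is the distance of its endpoints.  The geodesic is defined on all of R:
   on a complete manifold every geodesic continues indefinitely. *)
Definition shortest_geodesic (R : realType) (n : nat)
    (M : riemannian_manifold R n) (g : R -> M) (p q : M) : Prop :=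
  [/\ geodesic g, g 0 = p, g 1 = q & constant_speed g (dist p q)].

(* The chosen shortest geodesics t |-> avg t p q, for those pairs p, q (the
   relation joinable) for which the geodesic is well-defined.  Nothing is assumed
   about avg outside joinable. *)
Record geodesic_averages (R : realType) (n : nat) (M : riemannian_manifold R n) :=
  GeodesicAverages {
    joinable : M -> M -> Prop;
    avg : R -> M -> M -> M;
    avgP : forall p q, joinable p q ->
      shortest_geodesic (fun t => avg t p q) p q
  }.

(* The average avg t p q is well-defined.  The distance identities are a genuine
   requirement only for t outside [0, 1], where the continuation of a shortest
   geodesic need not be shortest. *)
Definition avg_well_defined (R : realType) (n : nat) (M : riemannian_manifold R n)
    (A : geodesic_averages M) (t : R) (p q : M) : Prop :=
  [/\ joinable A p q,
      dist (avg A t p q) q = `|1 - t| * dist p q &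
      dist p (avg A t p q) = `|t| * dist p q].

(** * Linear subdivision schemes *)

Definition symbol (R : realType) (a : int -> R) (z : R[i]) : R[i] :=
  \sum_(i \in [set: int]) (real_complex R (a i)) * z ^ i.

Definition linear_scheme (R : realType) (a : int -> R)
    (S : (int -> R) -> (int -> R)) : Prop :=
  finite_set [set i | a i != 0] /\
  forall f j, S f j = \sum_(i \in [set: int]) a (j - 2%:Z * i) * f i.

(* The modulus of a complex number, as an element of R. *)
Definition modulus (R : realType) (z : R[i]) : R :=
  ComplexField.Normc.normc z.

Definition pyramid_denom (R : realType) (beta : R[i]) : R :=
  1 + 2 * complex.Re beta + modulus beta ^+ 2.

(* The real numbers alpha 1, ..., alpha m1 belong to the linear factors (the other
   values of alpha are irrelevant); beta is the coefficient of the quadratic one. *)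
Definition factored_symbol (R : realType) (s : int) (m1 : nat) (alpha : nat -> R)
    (beta : R[i]) (z : R[i]) : R[i] :=
  z ^ (- s) * (1 + z) *
  (\prod_(1 <= i < m1.+1)
     ((1 + real_complex R (alpha i) * z) / real_complex R (1 + alpha i))) *
  ((1 + real_complex R (2 * complex.Re beta) * z
      + real_complex R (modulus beta ^+ 2) * z ^+ 2)
    / real_complex R (pyramid_denom beta)).

(** * The nonlinear scheme *)

Definition pyramid_w1 (R : realType) (beta : R[i]) : R := 1 / pyramid_denom beta.
Definition pyramid_w3 (R : realType) (beta : R[i]) : R :=
  modulus beta ^+ 2 / pyramid_denom beta.
Definition pyramid_r (R : realType) (beta : R[i]) : R := 1 / (1 + modulus beta).
Definition pyramid_t1 (R : realType) (beta : R[i]) : R :=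
  pyramid_w1 beta / pyramid_r beta.
Definition pyramid_t2 (R : realType) (beta : R[i]) : R :=
  1 - pyramid_w3 beta / (1 - pyramid_r beta).

Definition pyramid (R : realType) (n : nat) (M : riemannian_manifold R n)
    (A : geodesic_averages M) (beta : R[i]) (p1 p2 p3 : M) : M :=
  avg A (pyramid_r beta)
    (avg A (pyramid_t2 beta) p3 p2) (avg A (pyramid_t1 beta) p2 p1).

Definition pyramid_well_defined (R : realType) (n : nat)
    (M : riemannian_manifold R n) (A : geodesic_averages M) (beta : R[i])
    (p1 p2 p3 : M) : Prop :=
  [/\ avg_well_defined A (pyramid_t2 beta) p3 p2,
      avg_well_defined A (pyramid_t1 beta) p2 p1 &
      avg_well_defined A (pyramid_r beta)
        (avg A (pyramid_t2 beta) p3 p2) (avg A (pyramid_t1 beta) p2 p1)].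

(* q_(i, j) for j <= m1. *)
Fixpoint linear_rounds (R : realType) (n : nat) (M : riemannian_manifold R n)
    (A : geodesic_averages M) (alpha : nat -> R) (p : int -> M) (j : nat) :
    int -> M :=
  match j with
  | 0 => fun i => p (i %/ 2)%Z
  | j'.+1 => fun i =>
      avg A (alpha j / (1 + alpha j))
        (linear_rounds A alpha p j' i) (linear_rounds A alpha p j' (i + 1))
  end.

Definition global_step (R : realType) (n : nat) (M : riemannian_manifold R n)
    (A : geodesic_averages M) (s : int) (m1 : nat) (alpha : nat -> R)
    (beta : R[i]) (p : int -> M) : int -> M :=
  let q := linear_rounds A alpha p m1 in
  fun k => let i := k + s - 1 in pyramid A beta (q i) (q (i + 1)) (q (i + 2)).

Definition global_step_well_defined (R : realType) (n : nat)
    (M : riemannian_manifold R n) (A : geodesic_averages M) (m1 : nat)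
    (alpha : nat -> R) (beta : R[i]) (p : int -> M) : Prop :=
  let q := linear_rounds A alpha p in
  (forall (j : nat) (i : int), (1 <= j <= m1)%N ->
     avg_well_defined A (alpha j / (1 + alpha j)) (q j.-1 i) (q j.-1 (i + 1))) /\
  (forall i : int,
     pyramid_well_defined A beta (q m1 i) (q m1 (i + 1)) (q m1 (i + 2))).

Definition delta (R : realType) (n : nat) (M : riemannian_manifold R n)
    (p : int -> M) : \bar R :=
  ereal_sup [set (dist (p i) (p (i + 1)))%:E | i in [set: int]].

Definition refined (R : realType) (n : nat) (M : riemannian_manifold R n)
    (A : geodesic_averages M) (s : int) (m1 : nat) (alpha : nat -> R)
    (beta : R[i]) (p : int -> M) (k : nat) : int -> M :=
  iter k (global_step A s m1 alpha beta) p.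

Definition admissible (R : realType) (n : nat) (M : riemannian_manifold R n)
    (A : geodesic_averages M) (p : int -> M) : Prop :=
  (forall i, joinable A (p i) (p (i + 1))) /\ (delta p < +oo)%E.

Definition refinement_well_defined (R : realType) (n : nat)
    (M : riemannian_manifold R n) (A : geodesic_averages M) (s : int) (m1 : nat)
    (alpha : nat -> R) (beta : R[i]) (p : int -> M) : Prop :=
  forall k, global_step_well_defined A m1 alpha beta
              (refined A s m1 alpha beta p k).

Definition interpolant (R : realType) (n : nat) (M : riemannian_manifold R n)
    (A : geodesic_averages M) (k : nat) (q : int -> M) (x : R) : M :=
  let y := x * 2 ^+ k in
  let i := Num.floor y in
  avg A (y - i%:~R) (q i) (q (i + 1)).

Definition converges_from (R : realType) (n : nat) (M : riemannian_manifold R n)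
    (A : geodesic_averages M) (s : int) (m1 : nat) (alpha : nat -> R)
    (beta : R[i]) (p : int -> M) : Prop :=
  exists F : R -> M, forall e : R, 0 < e ->
    exists N, forall k, (N <= k)%N -> forall x : R,
      dist (interpolant A k (refined A s m1 alpha beta p k) x) (F x) < e.

(** * The exceptional set *)

Definition linear_rate (R : realType) (a : R) : R :=
  Num.max (1 / (1 + a)) (a / (1 + a)).

(* For m1 >= 1 this is the minimum of linear_rate (alpha i) over 1 <= i <= m1: the
   default value of the iterated min is one of these numbers. *)
Definition mu1 (R : realType) (m1 : nat) (alpha : nat -> R) : R :=
  \big[Num.min/linear_rate (alpha 1%N)]_(1 <= i < m1.+1) linear_rate (alpha i).

Definition upsilon (R : realType) (mu : R) : R := acos ((3 * mu - 1) / (1 + mu)).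

Definition rho_center (R : realType) (mu phi : R) : R :=
  - (1 + mu) / (1 - mu) * cos phi + 2 * mu / (1 - mu).

Definition rho1 (R : realType) (mu phi : R) : R :=
  rho_center mu phi - Num.sqrt (rho_center mu phi ^+ 2 - 1).

Definition rho2 (R : realType) (mu phi : R) : R :=
  rho_center mu phi + Num.sqrt (rho_center mu phi ^+ 2 - 1).

Definition polar (R : realType) (r phi : R) : R[i] :=
  Complex (r * cos phi) (r * sin phi).

Definition Omega (R : realType) (mu : R) : set R[i] :=
  [set z | exists r phi : R,
     [/\ z = polar r phi, rho1 mu phi <= r <= rho2 mu phi &
         upsilon mu < phi < 2 * pi - upsilon mu]]
  `|` [set polar 1 (upsilon mu); polar 1 (- upsilon mu)].

(* Main.v *)
(* With mu the contraction factor of the first linear round, all distances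
   between neighbours are at most mu D after the linear rounds, because the
   later rounds only average.  Write r = |beta|, x = Re beta, Dn = |1 + beta|^2.
   For four consecutive points p1, ..., p4, the inner averages M_t2(p3, p2) and
   M_t1(p3, p2) used by two successive pyramids lie on the same geodesic, so that
   the triangle inequality through them bounds the distance of the two pyramid
   averages by
     (d(p1, p2) + (4 r - 2 x) d(p2, p3) + r^2 d(p3, p4)) / Dn.
   The resulting factor mu (1 + 4 r - 2 x + r^2) / Dn is less than 1 exactly when
   r^2 - 2 K r + 1 > 0, where K is rho_center at the argument of beta, that is,
   when beta lies outside Omega.  Hence successive interpolants differ by a
   geometrically decreasing amount and converge uniformly by completeness. *)

Require Import Defs.
From mathcomp Require Import all_boot all_order all_algebra.
From mathcomp Require Import complex.
From mathcomp Require Import all_classical all_reals all_analysis.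
From mathcomp Require Import ring lra zify.
Set Implicit Arguments.
Unset Strict Implicit.
Unset Printing Implicit Defensive.
Import Order.TTheory GRing.Theory Num.Theory.
Import numFieldNormedType.Exports.
Local Open Scope classical_set_scope.
Local Open Scope ring_scope.

(** * The Riemannian distance *)

Lemma path_length_ge0 (R : realType) (n : nat) (M : riemannian_manifold R n)
    (p q : M) (L : R) : path_length p q L -> 0 <= L.
Proof.
elim=> // c x a b q' L' _ _ _ _ _ L'0.
by rewrite addr_ge0//; apply: Rintegral_ge0 => t _; exact: sqrtr_ge0.
Qed.

Lemma path_length_cat (R : realType) (n : nat) (M : riemannian_manifold R n)
    (p q r : M) (L L' : R) :
  path_length p q L -> path_length q r L' -> path_length p r (L + L').
Proof.
elim=> [p'|c x a b q' {}L ab xc xd xC _ IH] qr; first by rewrite add0r.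
by rewrite -addrA; apply: path_length_cons => //; exact: IH.
Qed.

Lemma path_length_segment (R : realType) (n : nat)
    (M : riemannian_manifold R n) (c : chart_index M) (x : R -> 'rV[R]_n)
    (a b : R) :
  a <= b ->
  (forall t, t \in `[a, b] -> chart_img c (x t)) ->
  (forall t, t \in `[a, b] -> derivable x t 1) ->
  {within `[a, b], continuous (derive1 x)} ->
  path_length (chart_inv c (x a)) (chart_inv c (x b))
    (\int[lebesgue_measure]_(t in `[a, b]) speed c x t).
Proof.
move=> ab xc xd xC; rewrite -[X in path_length _ _ X]addr0.
by apply: path_length_cons => //; exact: path_length_nil.
Qed.

(** The substitution t -> -t in the length integral of [path_length_sym] asks for a continuous
    integrand. Written as a finite sum of products of coordinates and metric entries, the quadratic
    form passes to the limit term by term. *)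
Lemma speed_continuous (R : realType) (n : nat) (M : riemannian_manifold R n)
    (c : chart_index M) (x : R -> 'rV[R]_n) (a b : R) :
  (forall t, t \in `[a, b] -> chart_img c (x t)) ->
  (forall t, t \in `[a, b] -> derivable x t 1) ->
  {within `[a, b], continuous (derive1 x)} ->
  {within `[a, b], continuous (speed c x)}.
Proof.
move=> xc xd /subspace_continuousP xC; apply/subspace_continuousP => t tab.
have tab' : t \in `[a, b] by [].
set F := within _ _; have FF : Filter F by exact: within_filter.
suff : quad_form (metric c (x s)) (derive1 x s) @[s --> F] -->
    quad_form (metric c (x t)) (derive1 x t).
  by move=> /cvg_comp; apply; exact: sqrt_continuous.
have dE i : (derive1 x s 0 i) @[s --> F] --> derive1 x t 0 i.
  exact: (cvg_comp _ (fun A : 'rV[R]_n => A 0 i) (xC t tab)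
            (@coord_continuous _ _ _ _ _ _)).
have mE i j : (metric c (x s) i j) @[s --> F] --> metric c (x t) i j.
  have xt : x s @[s --> F] --> x t.
    apply: cvg_within_filter.
    exact: (differentiable_continuous (proj1 (derivable1_diffP _ _) (xd t tab'))).
  apply: (cvg_comp _ (fun y : 'rV[R]_n => metric c y i j) xt).
  have := @metric_smooth _ _ M c i j 0%N.
  rewrite /= continuous_open_subspace; last exact: chart_img_open.
  by apply; rewrite inE; exact: xc.
have -> : (fun s => quad_form (metric c (x s)) (x^`()%classic s)) =
  (fun s => \sum_(j < n) (\sum_(i < n) derive1 x s 0 i * metric c (x s) i j)
                     * derive1 x s 0 j).
  apply/funext => s; rewrite /quad_form !mxE; apply: eq_bigr => j _.
  by rewrite !mxE.
rewrite /quad_form !mxE.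
under [X in _ --> X]eq_bigr do rewrite !mxE.
apply: cvg_big => [|j _]; first exact: add_continuous.
apply: cvgM; last exact: dE.
apply: cvg_big => [|i _]; first exact: add_continuous.
by apply: cvgM; [exact: dE|exact: mE].
Qed.

Lemma is_derive_compN (R : realType) (V : normedModType R) (x : R -> V)
    (t : R) :
  derivable x (- t) 1 -> is_derive t 1 (x \o -%R) (- derive1 x (- t)).
Proof.
move=> /derivable1_diffP dx.
have dN : differentiable (-%R : R -> R) t.
  by apply/derivable1_diffP; exact: ex_derive.
have dc : differentiable (x \o -%R) t by exact: differentiable_comp.
apply: DeriveDef; first exact/derivable1_diffP.
have dN1 : 'd (-%R : R -> R) t 1 = - 1 by rewrite -deriveE// derive_val.
by rewrite deriveE// diff_comp//= dN1 linearN derive1E'.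
Qed.

(** Each piece is run backwards on [-b, -a]: its derivative changes sign, the quadratic form is
    even, so the length is kept. The reversed pieces are concatenated in the opposite order. *)
Lemma path_length_sym (R : realType) (n : nat) (M : riemannian_manifold R n)
    (p q : M) (L : R) : path_length p q L -> path_length q p L.
Proof.
elim=> [p'|c x a b q' {}L ab xc xd xC _ IH]; first exact: path_length_nil.
rewrite addrC; apply: (path_length_cat IH).
have oppab t : t \in `[- b, - a] -> - t \in `[a, b].
  by rewrite !in_itv/= lerNr lerNl andbC.
have yd t : t \in `[- b, - a] ->
    is_derive t 1 (x \o -%R) (- derive1 x (- t)).
  by move=> /oppab/xd; exact: is_derive_compN.
have -> : \int[lebesgue_measure]_(t in `[a, b]) speed c x t =
    \int[lebesgue_measure]_(t in `[- b, - a]) speed c (x \o -%R) t.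
  have ba : - b <= - a by rewrite lerN2.
  have xS : {within `[- - a, - - b], continuous (speed c x)}.
    by rewrite !opprK; exact: speed_continuous.
  have xI := integration_by_substitution_oppr ba xS.
  transitivity (\int[lebesgue_measure]_(t in `[- b, - a]) speed c x (- t)).
    by rewrite /Rintegral -xI !opprK.
  apply: eq_Rintegral => t; rewrite inE => /= tab.
  have ? := yd t tab.
  rewrite /speed [in RHS]derive1E derive_val /quad_form/=.
  by rewrite [(- _)^T]linearN/= mulNmx mulmxN mulNmx opprK.
have xE u : x u = (x \o -%R) (- u) by rewrite /= opprK.
rewrite (xE a) (xE b); apply: path_length_segment; rewrite ?lerN2//.
- by move=> t /oppab; exact: xc.
- by move=> t /yd ?; exact: ex_derive.
- move/subspace_continuousP : xC => xC.
  apply/subspace_continuousP => t tab.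
  suff : derive1 (x \o -%R) s @[s --> within `[- b, - a]%classic (nbhs t)]
      --> derive1 (x \o -%R) t by [].
  have -> : derive1 (x \o -%R) t = - derive1 x (- t).
    by have ? := yd t tab; rewrite derive1E derive_val.
  have : - derive1 x (- s) @[s --> within `[- b, - a]%classic (nbhs t)]
      --> - derive1 x (- t).
    apply: cvgN.
    apply: (cvg_comp -%R (derive1 x) _ (xC (- t) (oppab _ tab))).
    move=> P /= [e /= e0 Pe]; exists e => //= s se sab; apply: Pe.
      by rewrite /= -opprD normrN.
    exact: oppab.
  (* The formula for the derivative of the reversed curve is known only on the interval, which is
     enough for a limit within it. *)
  apply: cvg_trans; apply: near_eq_cvg.
  near=> s.
  have sab : s \in `[- b, - a] by near: s; exact: withinT.
  have ? := yd s sab.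
  by rewrite [RHS]derive1E derive_val.
Unshelve. all: end_near. Qed.

(** A ball around the coordinates of [p] fits into the open chart image, and straight segments
    inside this ball are admissible pieces. *)
Lemma path_length_near (R : realType) (n : nat) (M : riemannian_manifold R n)
    (p : M) : \forall q \near p, exists L, path_length p q L.
Proof.
have [c cp] := chart_cover p.
have ci q : chart_dom c q -> chart_img c (chart c q) by move=> cq; exists q.
have /nbhs_ballP[e /= e0 ye] : nbhs (chart c p) (chart_img c).
  by apply: open_nbhs_nbhs; split; [exact: chart_img_open|exact: ci].
have dp : nbhs p (chart_dom c).
  by apply: open_nbhs_nbhs; split => //; exact: chart_dom_open.
have cC : chart c q @[q --> p] --> chart c p.
  have := @chart_continuous _ _ M c.
  rewrite continuous_open_subspace; last exact: chart_dom_open.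
  by apply; rewrite inE.
near=> q.
have cq : chart_dom c q by near: q.
have : ball (chart c p) e (chart c q).
  by near: q; apply: cC; exact: nbhsx_ballx.
rewrite -ball_normE/= => pq.
set v := chart c q - chart c p.
pose x : R -> 'rV[R]_n := cst (chart c p) + *:%R^~ v.
have xd (t : R) : is_derive t 1 x v.
  have dx : is_diff t x (0 + *:%R^~ v) by exact: is_diffD.
  apply: DeriveDef; first by apply/derivable1_diffP; exact: ex_diff.
  by rewrite deriveE// diff_val fctE/= add0r scale1r.
have xE (t : R) : x t = chart c p + t *: v by [].
have -> : q = chart_inv c (x 1) by rewrite xE scale1r addrC subrK chartK.
have -> : p = chart_inv c (x 0) by rewrite xE scale0r addr0 chartK.
eexists; apply: path_length_segment => // [t|].
- rewrite in_itv/= => /andP[t0 t1].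
  apply: ye; rewrite -ball_normE/= xE opprD addrA subrr sub0r normrN.
  rewrite normrZ ger0_norm// -[e]mul1r (le_lt_trans (ler_wpM2r _ t1))//.
  by rewrite !mul1r distrC.
- apply: continuous_subspaceT.
  rewrite (_ : derive1 _ = cst v); first exact: cst_continuous.
  by apply/funext => t; rewrite derive1E derive_val.
Unshelve. all: end_near. Qed.

(* The points reachable from p form a clopen set. *)
Lemma path_length_exists (R : realType) (n : nat) (M : riemannian_manifold R n)
    (M_connected : connected [set: M]) (p q : M) :
  exists L, path_length p q L.
Proof.
pose U := [set q | exists L, path_length p q L].
suff UT : U = setT by rewrite -[exists L, _]/(U q) UT.
apply: M_connected; first by exists p, 0; exact: path_length_nil.
- exists U; last by rewrite setTI.
  rewrite openE => r [L pr].
  apply: filterS (path_length_near r) => r' [L' rr'].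
  by exists (L + L'); exact: path_length_cat pr rr'.
- exists U; last by rewrite setTI.
  rewrite -openC openE => r nUr.
  apply: filterS (path_length_near r) => r' [L' rr'] [L pr'].
  by apply: nUr; exists (L + L'); apply: path_length_cat pr' (path_length_sym rr').
Qed.

Lemma dist_le (R : realType) (n : nat) (M : riemannian_manifold R n)
    (p q : M) (L : R) : path_length p q L -> dist p q <= L.
Proof.
by move=> pq; apply: ge_inf => //; exists 0 => L'; exact: path_length_ge0.
Qed.

Lemma dist_ge0 (R : realType) (n : nat) (M : riemannian_manifold R n)
    (p q : M) : 0 <= dist p q.
Proof.
rewrite /dist; have [->|/set0P pq0] := eqVneq [set L | path_length p q L] set0.
  by rewrite inf0.
by apply: lb_le_inf => // L; exact: path_length_ge0.
Qed.

Lemma dist_refl (R : realType) (n : nat) (M : riemannian_manifold R n) (p : M) :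
  dist p p = 0.
Proof.
by apply/eqP; rewrite eq_le dist_ge0 andbT; apply: dist_le; exact: path_length_nil.
Qed.

Lemma dist_sym (R : realType) (n : nat) (M : riemannian_manifold R n) (p q : M) :
  dist p q = dist q p.
Proof.
by rewrite /dist; congr inf; apply/seteqP; split => L; exact: path_length_sym.
Qed.

Lemma dist_triangle (R : realType) (n : nat) (M : riemannian_manifold R n)
    (M_connected : connected [set: M]) (q p r : M) :
  dist p r <= dist p q + dist q r.
Proof.
apply/ler_addgt0Pr => e e0; have e20 : 0 < e / 2 by rewrite divr_gt0.
(* Connectedness enters here: every set of lengths is nonempty, so each infimum is approached by
   actual curves, which can be concatenated. *)
have infP p' q' : has_inf [set L | @path_length R n M p' q' L].
  by split; [exact: path_length_exists|exists 0 => L; exact: path_length_ge0].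
have [L pq Le] := inf_adherent e20 (infP p q).
have [L' qr L'e] := inf_adherent e20 (infP q r).
apply: le_trans (dist_le (path_length_cat pq qr)) _.
rewrite /dist; lra.
Qed.

(** * Length along geodesics *)

(** By continuity the geodesic stays in one chart near [t]; there it is a single piece with constant
    integrand [v]. *)
Lemma geodesic_path_length_near (R : realType) (n : nat)
    (M : riemannian_manifold R n) (g : R -> M) (v : R) (t : R) :
  geodesic g -> constant_speed g v ->
  exists2 e : R, 0 < e & forall a b, a <= b -> t - e < a -> b < t + e ->
    path_length (g a) (g b) (v * (b - a)).
Proof.
move=> [gC gG] gv; have [c cp] := chart_cover (g t).
have : nbhs t (g @^-1` chart_dom c).
  apply: gC; apply: open_nbhs_nbhs; split => //; exact: chart_dom_open.
move=> /nbhs_ballP[e /= e0 te]; exists e => // a b ab ta tb.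
have cg s : s \in `[a, b] -> chart_dom c (g s).
  rewrite in_itv/= => /andP[as_ sb]; apply: te.
  by rewrite /ball/= ltr_norml; apply/andP; split; lra.
have aab : a \in `[a, b] by rewrite in_itv/= lexx.
have bab : b \in `[a, b] by rewrite in_itv/= lexx andbT.
rewrite -(chartK (cg a aab)) -(chartK (cg b bab)).
have -> : v * (b - a) =
    \int[lebesgue_measure]_(s in `[a, b]) speed c (chart c \o g) s.
  rewrite (@eq_Rintegral _ _ _ _ _ (cst v)).
    rewrite Rintegral_cst//= lebesgue_measure_itv/= lte_fin.
    move: ab; rewrite le_eqVlt => /predU1P[->|->]; last by rewrite -EFinB.
    by rewrite ltxx subrr.
  by move=> s; rewrite inE/= => sab; exact: gv (cg s sab).
apply: (@path_length_segment _ _ _ c (chart c \o g)) => //.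
- by move=> s sab; exists (g s) => //; exact: cg.
- move=> s sab; have [xd _ _] := gG s c (cg s sab); exact: nbhs_singleton xd.
- apply: continuous_in_subspaceT => s; rewrite inE/= => sab.
  have [_ /derivable1_diffP xd _] := gG s c (cg s sab).
  exact: differentiable_continuous.
Qed.

Lemma geodesic_path_length (R : realType) (n : nat)
    (M : riemannian_manifold R n) (g : R -> M) (v a b : R) :
  geodesic g -> constant_speed g v -> a <= b ->
  path_length (g a) (g b) (v * (b - a)).
Proof.
move=> gG gv ab.
(* The times reachable from a along g form a set whose supremum is b. *)
pose E := [set t | a <= t <= b /\ path_length (g a) (g t) (v * (t - a))].
have Ea : E a.
  by split; [rewrite lexx ab|rewrite subrr mulr0; exact: path_length_nil].
have Eub : ubound E b by move=> t [/andP[]].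
have Esup : has_sup E by split; [exists a|exists b].
have [e e0 eP] := geodesic_path_length_near (sup E) gG gv.
have [t Et te] := sup_adherent e0 Esup.
have tsup : t <= sup E by apply: ub_le_sup => //; exists b.
have supb : sup E <= b by apply: ge_sup => //; exists a.
case: Et => /andP[at_ tb] gat.
(* One local piece around the supremum leads from [t] to [u], so [u] is again in [E]. As [u] cannot
   exceed the supremum, the minimum must be [b]. *)
pose u := Num.min b (sup E + e / 2).
have ub : u <= b by rewrite ge_min lexx.
have tu : t <= u by rewrite le_min tb; lra.
have ue : u < sup E + e by rewrite gt_min; apply/orP; right; lra.
have Eu : E u.
  split; first by rewrite ub (le_trans at_).
  have := path_length_cat gat (eP _ _ tu te ue).
  by congr path_length; ring.
have usup : u <= sup E by apply: ub_le_sup => //; exists b.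
have bu : u = b.
  apply/min_l; move: usup; rewrite /u minEle; case: ifP => //; lra.
by case: Eu; rewrite bu.
Qed.

Lemma dist_geodesic (R : realType) (n : nat) (M : riemannian_manifold R n)
    (g : R -> M) (v a b : R) :
  geodesic g -> constant_speed g v -> dist (g a) (g b) <= v * `|b - a|.
Proof.
move=> gG gv; have [ab|/ltW ba] := leP a b.
  by rewrite ger0_norm ?subr_ge0//; exact: dist_le (geodesic_path_length gG gv _).
rewrite dist_sym ler0_norm ?subr_le0// opprB.
by exact: dist_le (geodesic_path_length gG gv _).
Qed.

(** [avg_well_defined] measures distances to the two endpoints only. Two parameters on one geodesic,
    possibly outside [0, 1], are compared through the length of the arc between them, hence an
    inequality. *)
Lemma dist_avg (R : realType) (n : nat) (M : riemannian_manifold R n)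
    (A : geodesic_averages M) (p q : M) (t u : R) :
  joinable A p q -> dist (avg A t p q) (avg A u p q) <= `|u - t| * dist p q.
Proof. by move=> /avgP[gG _ _ gv]; rewrite mulrC; exact: (dist_geodesic _ _ gG gv). Qed.

Lemma dist_avg0 (R : realType) (n : nat) (M : riemannian_manifold R n)
    (A : geodesic_averages M) (p q : M) (t : R) :
  joinable A p q -> dist p (avg A t p q) <= `|t| * dist p q.
Proof.
move=> pq; have [_ p0 _ _] := avgP pq.
by have := dist_avg 0 t pq; rewrite p0 subr0.
Qed.

(** * The exceptional set *)

Lemma modulus_sqr (R : realType) (z : R[i]) :
  modulus z ^+ 2 = complex.Re z ^+ 2 + complex.Im z ^+ 2.
Proof. by case: z => x y /=; rewrite sqr_sqrtr// addr_ge0// sqr_ge0. Qed.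

Lemma modulus_ge0 (R : realType) (z : R[i]) : 0 <= modulus z.
Proof. by case: z => x y; exact: sqrtr_ge0. Qed.

Lemma modulus_gt0 (R : realType) (z : R[i]) :
  complex.Im z != 0 -> 0 < modulus z.
Proof.
move=> z0; rewrite lt_neqAle modulus_ge0 andbT eq_sym -sqrf_eq0 modulus_sqr.
by rewrite gt_eqF// ltr_wpDl ?sqr_ge0// lt_neqAle sqr_ge0 eq_sym sqrf_eq0 z0.
Qed.

Lemma normr_Re_lt_modulus (R : realType) (z : R[i]) :
  complex.Im z != 0 -> `|complex.Re z| < modulus z.
Proof.
move=> z0; rewrite -(@ltr_pXn2r _ 2)// ?nnegrE ?modulus_ge0//.
rewrite real_normK ?num_real// modulus_sqr ltrDl.
by rewrite lt_neqAle sqr_ge0 eq_sym sqrf_eq0 z0.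
Qed.

Lemma pyramid_denom_gt0 (R : realType) (z : R[i]) :
  complex.Im z != 0 -> 0 < pyramid_denom z.
Proof.
move=> z0; rewrite /pyramid_denom modulus_sqr.
have : 0 < complex.Im z ^+ 2 by rewrite lt_neqAle sqr_ge0 eq_sym sqrf_eq0 z0.
by have := sqr_ge0 (complex.Re z + 1); lra.
Qed.

(** The condition rho1 <= r <= rho2 in a form without roots: it amounts to r^2 - 2 K r + 1 <= 0 and
    forces K^2 >= 1, so the square root in rho1 and rho2 is a genuine one. *)
Lemma mem_Omega (R : realType) (mu phi : R) (z : R[i]) :
  let K := rho_center mu phi in
  z = polar (modulus z) phi -> upsilon mu < phi < 2 * pi - upsilon mu ->
  (modulus z - K) ^+ 2 <= K ^+ 2 - 1 -> Omega mu z.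
Proof.
move=> K zE phiE KE; left; exists (modulus z), phi; split => //.
have K1 : 0 <= K ^+ 2 - 1 by rewrite (le_trans (sqr_ge0 _) KE).
have : `|modulus z - K| <= Num.sqrt (K ^+ 2 - 1).
  by rewrite -sqrtr_sqr ler_sqrt.
by rewrite ler_norml /rho1 /rho2 -/K => /andP[? ?]; apply/andP; split; lra.
Qed.

(** By contraposition: if the factor is at least 1, then r^2 - 2 K r + 1 <= 0, where k is the cosine
    of the argument of [beta] and K the corresponding [rho_center]. This inequality yields both the
    radial and the angular condition of [Omega]. *)
Lemma pyramid_contraction (R : realType) (mu : R) (beta : R[i]) :
  2^-1 <= mu < 1 -> complex.Im beta != 0 -> ~ Omega mu beta ->
  mu * (1 + (4 * modulus beta - 2 * complex.Re beta) + modulus beta ^+ 2)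
    < pyramid_denom beta.
Proof.
move=> /andP[mu2 mu1] b0 nOmega; rewrite ltNge; apply/negP => denom_le.
apply: nOmega; move: denom_le; rewrite /pyramid_denom.
have r0 := modulus_gt0 b0; have r2 := modulus_sqr beta.
have xr := normr_Re_lt_modulus b0.
set r := modulus beta in r0 r2 xr *; set x := complex.Re beta in r2 xr *.
set y := complex.Im beta in b0 r2 *.
move=> denom_le; pose k := x / r; pose k0 := (3 * mu - 1) / (1 + mu).
have xE : x = k * r by rewrite /k divfK ?gt_eqF.
have [k1 k2] : -1 < k /\ k < 1.
  by move: xr; rewrite ltr_norml /k ltr_pdivlMr// ltr_pdivrMr// mulN1r mul1r => /andP[].
have k0E : k0 * (1 + mu) = 3 * mu - 1 by rewrite /k0 divfK// gt_eqF; lra.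
have [k01 k02] : -1 < k0 /\ k0 < 1 by rewrite /k0 ltr_pdivlMr ?ltr_pdivrMr; lra.
pose phi0 := acos k.
have phi0C : cos phi0 = k by rewrite acosK// in_itv/= !ltW.
have phi0_gt0 : 0 < phi0 by rewrite acos_gt0// k2 ltW.
have phi0_ltpi : phi0 < pi by rewrite acos_ltpi// k1 ltW.
have uC : cos (upsilon mu) = k0 by rewrite acosK// in_itv/= !ltW.
have u0 : 0 <= upsilon mu by rewrite acos_ge0// !ltW.
have upi : upsilon mu <= pi by rewrite acos_lepi// !ltW.
have phi0S : sin phi0 = `|y| / r.
  rewrite sin_acos ?ltW// (_ : 1 - k ^+ 2 = (y / r) ^+ 2).
    by rewrite sqrtr_sqr normrM normfV (gtr0_norm r0).
  apply: (@mulIf _ (r ^+ 2)); rewrite ?expf_neq0 ?gt_eqF//.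
  by rewrite mulrBl -!exprMn -xE divfK ?gt_eqF// mul1r r2; ring.
pose K := (2 * mu - (1 + mu) * k) / (1 - mu).
have KE : K * (1 - mu) = 2 * mu - (1 + mu) * k.
  by rewrite /K divfK// gt_eqF// subr_gt0.
have centerE phi : cos phi = k -> rho_center mu phi = K.
  by rewrite /rho_center => ->; rewrite /K; ring.
have KR : 1 + r ^+ 2 <= 2 * K * r.
  rewrite -(ler_pM2r (_ : 0 < 1 - mu)) ?subr_gt0//.
  rewrite (_ : 2 * K * r * _ = 2 * (K * (1 - mu)) * r); last by ring.
  by rewrite KE; move: denom_le; rewrite xE; nra.
(* From 2 r <= 1 + r^2 <= 2 K r. *)
have K1 : 1 <= K.
  rewrite -(ler_pM2r r0); have := sqr_ge0 (r - 1); nra.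
have KK : (r - K) ^+ 2 <= K ^+ 2 - 1 by nra.
(* K decreases in k and equals 1 at k0, the cosine of [upsilon mu]; so K >= 1 is the angular
   condition. *)
have kk0 : k <= k0.
  rewrite -(ler_pM2r (_ : 0 < 1 + mu)) ?k0E; last lra.
  by have : (1 - mu) <= K * (1 - mu); [rewrite ler_peMl// subr_ge0 ltW|lra].
have betaE : beta = Complex x y by rewrite /x /y; case: (beta).
have polarE phi : cos phi = k -> sin phi = y / r -> beta = polar r phi.
  by move=> pC pS; rewrite betaE /polar pC pS /k ![r * (_ / r)]mulrC !divfK ?gt_eqF.
(* On the boundary angle K = 1, hence (r - 1)^2 <= 0: only the two isolated points of [Omega] remain
   there. *)
have phiP : (upsilon mu = phi0 /\ r = 1) \/ upsilon mu < phi0.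
  move: kk0; rewrite le_eqVlt => /predU1P[kk0|kk0]; [left|right].
    split; first by rewrite /phi0 kk0.
    have K1E : K = 1.
      apply: (@mulIf _ (1 - mu)); first by rewrite gt_eqF// subr_gt0.
      by rewrite KE kk0; move: k0E; lra.
    apply/eqP; rewrite -subr_eq0 -sqrf_eq0 eq_le sqr_ge0 andbT.
    by move: KR; rewrite K1E; lra.
  rewrite -ltr_cos ?in_itv/= ?uC ?phi0C//; first by rewrite u0 upi.
  by rewrite !ltW.
have [y0|y0] : y = `|y| \/ y = - `|y|.
  by case: (leP 0 y) => [/ger0_norm|/ltr0_norm] ->; [left|right; rewrite opprK].
- have bE : beta = polar r phi0 by apply: polarE; rewrite ?phi0S -?y0.
  case: phiP => [[uE r1]|uphi]; first by right; left; rewrite bE uE r1.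
  apply: (@mem_Omega _ _ phi0) => //; last by rewrite centerE.
  by rewrite uphi/=; lra.
- have bE : beta = polar r (- phi0).
    by apply: polarE; rewrite ?cosN ?sinN// phi0S y0 normrN normr_id mulNr.
  case: phiP => [[uE r1]|uphi]; first by right; right; rewrite bE uE r1.
  (* In the lower half plane the argument -phi0 is moved by a full turn into the angular range of
     [Omega]. *)
  have phiC : cos (- phi0 + pi *+ 2) = k by rewrite cosD2pi cosN.
  apply: (@mem_Omega _ _ (- phi0 + pi *+ 2)); last by rewrite centerE.
    by rewrite [LHS]bE /polar cosD2pi sinD2pi.
  by rewrite mulr2n; apply/andP; split; lra.
Qed.

(** * Contractivity and convergence *)

Lemma linear_rate_bounds (R : realType) (a : R) :
  0 < a -> 2^-1 <= linear_rate a < 1.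
Proof.
move=> a0; have a1 : 0 < 1 + a by lra.
rewrite /linear_rate le_max gt_max !ler_pdivlMr// !ltr_pdivrMr//.
by apply/andP; split; [apply/orP; case: (leP a 1) => ?; [left|right]; lra|apply/andP; split; lra].
Qed.

(** The single bounds give the contraction of the first linear round, the unit sum the non-expansion
    of the later ones. *)
Lemma linear_weight (R : realType) (a : R) : 0 < a ->
  [/\ `|a / (1 + a)| <= linear_rate a, `|1 - a / (1 + a)| <= linear_rate a &
      `|1 - a / (1 + a)| + `|a / (1 + a)| = 1].
Proof.
move=> a0; have a1 : 0 < 1 + a by lra.
have -> : 1 - a / (1 + a) = 1 / (1 + a) by field; rewrite gt_eqF.
rewrite !ger0_norm ?divr_ge0//; try lra.
by split; rewrite /linear_rate ?le_max ?lexx ?orbT//; field; rewrite gt_eqF.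
Qed.

(** The two averages are compared through the common data point [q]. *)
Lemma dist_avg_avg (R : realType) (n : nat) (M : riemannian_manifold R n)
    (M_connected : connected [set: M]) (A : geodesic_averages M) (t : R)
    (p q r : M) :
  avg_well_defined A t p q -> avg_well_defined A t q r ->
  dist (avg A t p q) (avg A t q r) <=
    `|1 - t| * dist p q + `|t| * dist q r.
Proof.
by move=> [_ <- _] [_ _ <-]; exact: dist_triangle.
Qed.

(* Of two consecutive steps of the doubled sequence q_(i, 0), one is trivial. *)
Lemma halfD1 (i : int) :
  ((i + 1) %/ 2)%Z = (i %/ 2)%Z /\ ((i + 1 + 1) %/ 2)%Z = (i %/ 2)%Z + 1 \/
  ((i + 1) %/ 2)%Z = (i %/ 2)%Z + 1 /\ ((i + 1 + 1) %/ 2)%Z = ((i + 1) %/ 2)%Z.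
Proof. lia. Qed.

Lemma dist_linear_rounds (R : realType) (n : nat) (M : riemannian_manifold R n)
    (M_connected : connected [set: M]) (A : geodesic_averages M)
    (m1 : nat) (alpha : nat -> R) (beta : R[i]) (p : int -> M) (D : R) :
  (forall i : nat, (1 <= i <= m1)%N -> 0 < alpha i) ->
  global_step_well_defined A m1 alpha beta p ->
  (forall i, dist (p i) (p (i + 1)) <= D) ->
  forall j, (j < m1)%N -> forall i,
    dist (linear_rounds A alpha p j.+1 i) (linear_rounds A alpha p j.+1 (i + 1))
      <= linear_rate (alpha 1%N) * D.
Proof.
move=> alpha0 [wd _] pD; have D0 : 0 <= D := le_trans (dist_ge0 _ _) (pD 0).
elim=> [|j IH] jm i.
  have [ta tb _] := linear_weight (alpha0 1%N jm).
  apply: le_trans (dist_avg_avg M_connected (wd 1%N i jm) (wd 1%N (i + 1) jm)) _.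
  (* In the doubled sequence one of the two distances vanishes; the other carries a weight of at
     most the rate. *)
  rewrite /=; have [[-> ->]|[-> ->]] := halfD1 i; rewrite dist_refl mulr0.
    by rewrite add0r ler_pM ?normr_ge0 ?dist_ge0.
  by rewrite addr0 ler_pM ?normr_ge0 ?dist_ge0.
have jm' : (1 <= j.+2 <= m1)%N by [].
have [_ _ t1] := linear_weight (alpha0 j.+2 jm').
apply: le_trans (dist_avg_avg M_connected (wd j.+2 i jm') (wd j.+2 (i + 1) jm')) _.
rewrite -[leRHS]mul1r -[X in _ <= X * _]t1 mulrDl.
by apply: lerD; apply: ler_wpM2l; rewrite ?normr_ge0//; apply: IH; exact: ltnW.
Qed.

Lemma dist_linear_rounds0 (R : realType) (n : nat) (M : riemannian_manifold R n)
    (M_connected : connected [set: M]) (A : geodesic_averages M)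
    (m1 : nat) (alpha : nat -> R) (beta : R[i]) (p : int -> M) (D : R) :
  (forall i : nat, (1 <= i <= m1)%N -> 0 < alpha i) ->
  global_step_well_defined A m1 alpha beta p ->
  (forall i, dist (p i) (p (i + 1)) <= D) ->
  forall j, (j <= m1)%N -> forall i,
    dist (linear_rounds A alpha p j i) (p (i %/ 2)%Z) <= j%:R * D.
Proof.
move=> alpha0 wd pD; have D0 : 0 <= D := le_trans (dist_ge0 _ _) (pD 0).
elim=> [|j IH] jm i; first by rewrite /= dist_refl mul0r.
apply: le_trans (dist_triangle M_connected (linear_rounds A alpha p j i) _ _) _.
have -> : j.+1%:R * D = D + j%:R * D by rewrite -natr1; ring.
apply: lerD; last exact: IH (ltnW jm) i.
have [_ _ da] := wd.1 j.+1 i jm.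
have [ta _ _] := linear_weight (alpha0 j.+1 jm).
have /andP[_ /ltW rate1] := linear_rate_bounds (alpha0 j.+1 jm).
rewrite dist_sym da -[leRHS]mul1r ler_pM ?normr_ge0 ?dist_ge0//.
  exact: le_trans ta rate1.
(* Neighbours are within D in every round: before the first by doubling, afterwards by
   [dist_linear_rounds], whose rate is below 1. *)
case: j {IH da ta rate1} jm => [|j] jm /=.
  by have [[-> _]|[-> _]] := halfD1 i; rewrite ?dist_refl.
apply: le_trans (dist_linear_rounds M_connected alpha0 wd pD (ltnW jm) i) _.
have m1_ge1 : (1 <= 1 <= m1)%N by rewrite (leq_trans _ jm).
have /andP[_ /ltW] := linear_rate_bounds (alpha0 1%N m1_ge1).
by move=> rate1; rewrite ler_piMl.
Qed.

Lemma dist_pyramid (R : realType) (n : nat) (M : riemannian_manifold R n)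
    (M_connected : connected [set: M]) (A : geodesic_averages M)
    (beta : R[i]) (p1 p2 p3 p4 : M) (D : R) :
  complex.Im beta != 0 ->
  pyramid_well_defined A beta p1 p2 p3 ->
  pyramid_well_defined A beta p2 p3 p4 ->
  dist p1 p2 <= D -> dist p2 p3 <= D -> dist p3 p4 <= D ->
  dist (pyramid A beta p1 p2 p3) (pyramid A beta p2 p3 p4) <=
    (1 + (4 * modulus beta - 2 * complex.Re beta) + modulus beta ^+ 2)
      / pyramid_denom beta * D.
Proof.
move=> b0 [[_ da _] [_ _ db] [_ _ dP]] [[_ da' _] [j32 _ db'] [_ dP' _]].
move=> p12 p23 p34.
have Dn0 := pyramid_denom_gt0 b0; have m0 := modulus_gt0 b0.
have xm := le_lt_trans (ler_norm _) (normr_Re_lt_modulus b0).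
set t1 := pyramid_t1 beta in db db' dP dP' j32 *.
set t2 := pyramid_t2 beta in da da' dP dP' *.
set r := pyramid_r beta in dP dP' *.
rewrite /pyramid -/t1 -/t2 -/r.
set m := modulus beta in m0 xm *; set x := complex.Re beta in xm *.
set Dn := pyramid_denom beta in Dn0 *.
have m1 : 0 < 1 + m by lra.
have nz : (1 + m != 0) * (Dn != 0) * (m != 0) by rewrite !gt_eqF.
have rE : 1 - r = m / (1 + m) by rewrite /r /pyramid_r -/m; field; rewrite nz.
have t1E : t1 = (1 + m) / Dn.
  by rewrite /t1 /pyramid_t1 /pyramid_w1 /pyramid_r -/m -/Dn; field; rewrite !nz.
have t2E : 1 - t2 = m * (1 + m) / Dn.
  rewrite /t2 /pyramid_t2 -/r rE /pyramid_w3 -/m -/Dn; field.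
  by rewrite !nz.
(* This difference is positive because Re beta < |beta|; hence the absolute values in [weights] open
   without a case distinction, whatever the sign of t2. *)
have t12 : t1 - t2 = 2 * (m - x) / Dn.
  have -> : t1 - t2 = (t1 + (1 - t2)) - 1 by ring.
  rewrite t1E t2E (_ : 2 * (m - x) = 1 + m + m * (1 + m) - Dn).
    by field; rewrite nz.
  by rewrite /Dn /pyramid_denom -/m -/x; ring.
have rB : `|r| + `|1 - r| = 1.
  have r0 : 0 <= r by rewrite /r /pyramid_r divr_ge0 ?ler01//; exact: ltW.
  by rewrite [`|r|]ger0_norm// rE ger0_norm ?divr_ge0 ?ltW// -rE; ring.
have weights : `|1 - t2| + `|t1| + `|t1 - t2| = (1 + (4 * m - 2 * x) + m ^+ 2) / Dn.
  rewrite t12 t2E t1E !ger0_norm ?divr_ge0 ?mulr_ge0 ?ltW// ?subr_gt0//.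
  by field; rewrite nz.
have p12' := p12; have p23' := p23; have p34' := p34.
rewrite dist_sym in p12'; rewrite dist_sym in p23'; rewrite dist_sym in p34'.
have dab (u v w : M) : dist u v <= D -> dist v w <= D ->
    `|1 - t2| * dist u v + `|t1| * dist v w <= (`|1 - t2| + `|t1|) * D.
  by move=> uv vw; rewrite mulrDl lerD// ler_wpM2l.
have ab : dist (avg A t2 p3 p2) (avg A t1 p2 p1) <= (`|1 - t2| + `|t1|) * D.
  apply: le_trans (dist_triangle M_connected p2 _ _) _.
  by rewrite da db; exact: dab.
have ab' : dist (avg A t2 p4 p3) (avg A t1 p3 p2) <= (`|1 - t2| + `|t1|) * D.
  apply: le_trans (dist_triangle M_connected p3 _ _) _.
  by rewrite da' db'; exact: dab.
have aa : dist (avg A t2 p3 p2) (avg A t1 p3 p2) <= `|t1 - t2| * D.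
  by apply: le_trans (dist_avg _ _ j32) _; rewrite ler_wpM2l.
(* The route is: first pyramid average, M_t2(p3, p2), M_t1(p3, p2), second pyramid average. The
   outer legs carry the weights r and 1 - r on the same bound, so together they count once. *)
apply: le_trans (dist_triangle M_connected (avg A t2 p3 p2) _ _) _.
apply: le_trans (lerD (lexx _) (dist_triangle M_connected (avg A t1 p3 p2) _ _)) _.
rewrite dist_sym dP [dist (avg A t1 p3 p2) _]dist_sym dP'.
apply: le_trans (lerD (ler_wpM2l (normr_ge0 r) ab)
  (lerD aa (ler_wpM2l (normr_ge0 (1 - r)) ab'))) _.
rewrite -weights; set W := `|1 - t2| + `|t1|.
have -> : `|r| * (W * D) + (`|t1 - t2| * D + `|1 - r| * (W * D)) =
    (`|r| + `|1 - r|) * W * D + `|t1 - t2| * D by ring.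
by rewrite rB mul1r -mulrDl.
Qed.

Lemma dist_pyramid0 (R : realType) (n : nat) (M : riemannian_manifold R n)
    (M_connected : connected [set: M]) (A : geodesic_averages M)
    (beta : R[i]) (p1 p2 p3 : M) (D : R) :
  pyramid_well_defined A beta p1 p2 p3 -> dist p1 p2 <= D -> dist p2 p3 <= D ->
  dist (pyramid A beta p1 p2 p3) p1 <=
    ((`|pyramid_r beta| + 1) * (`|1 - pyramid_t2 beta| + `|pyramid_t1 beta|) + 1)
      * D.
Proof.
move=> [[_ da _] [_ _ db] [_ _ dP]] p12 p23.
have p21 : dist p2 p1 <= D by rewrite dist_sym.
have p32 : dist p3 p2 <= D by rewrite dist_sym.
have D0 : 0 <= D := le_trans (dist_ge0 _ _) p12.
rewrite /pyramid; set t1 := pyramid_t1 beta in db dP *.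
set t2 := pyramid_t2 beta in da dP *; set r := pyramid_r beta in dP *.
have ap2 : dist (avg A t2 p3 p2) p2 <= `|1 - t2| * D.
  by rewrite da ler_wpM2l.
have ab : dist (avg A t2 p3 p2) (avg A t1 p2 p1) <= (`|1 - t2| + `|t1|) * D.
  apply: le_trans (dist_triangle M_connected p2 _ _) _.
  by rewrite mulrDl lerD// db ler_wpM2l.
apply: le_trans (dist_triangle M_connected (avg A t2 p3 p2) _ _) _.
apply: le_trans (lerD (lexx _) (dist_triangle M_connected p2 _ _)) _.
rewrite dist_sym dP.
apply: le_trans (lerD (ler_wpM2l (normr_ge0 r) ab) (lerD ap2 p21)) _.
(* The route through M_t2(p3, p2) and p2 needs only the weight |1 - t2| on its middle leg; adding
   |t1| D rounds the constant up. *)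
have : 0 <= `|t1| * D by rewrite mulr_ge0.
lra.
Qed.

Lemma dist_chain (R : realType) (n : nat) (M : riemannian_manifold R n)
    (M_connected : connected [set: M]) (p : int -> M) (D : R) :
  (forall i, dist (p i) (p (i + 1)) <= D) ->
  forall i j, dist (p i) (p j) <= `|i - j|%N%:R * D.
Proof.
move=> pD.
have up (k : nat) i : dist (p i) (p (i + k%:Z)) <= k%:R * D.
  elim: k => [|k IH]; first by rewrite addr0 dist_refl mul0r.
  apply: le_trans (dist_triangle M_connected (p (i + k%:Z)) _ _) _.
  rewrite -natr1 mulrDl mul1r lerD// (_ : i + k.+1 = i + k + 1)//; lia.
move=> i j; have [ij|/ltW ji] := leP i j.
  by have := up `|i - j|%N i; rewrite (_ : i + `|i - j|%N = j)//; lia.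
rewrite dist_sym.
by have := up `|i - j|%N j; rewrite (_ : j + `|i - j|%N = i)//; lia.
Qed.

(** The constants are chosen before [p] and [D], so the bounds can be iterated over all levels. The
    indices 2i and 2i + 1 are the left nodes of the two halves of the i-th grid cell. *)
Lemma global_step_bounds (R : realType) (n : nat) (M : riemannian_manifold R n)
    (M_connected : connected [set: M]) (A : geodesic_averages M)
    (s : int) (m1 : nat) (alpha : nat -> R) (beta : R[i]) :
  (1 <= m1)%N -> (forall i : nat, (1 <= i <= m1)%N -> 0 < alpha i) ->
  complex.Im beta != 0 -> ~ Omega (linear_rate (alpha 1%N)) beta ->
  exists gamma C : R, [/\ 0 <= gamma < 1, 0 <= C &
    forall (p : int -> M) (D : R),
    global_step_well_defined A m1 alpha beta p ->
    (forall i, dist (p i) (p (i + 1)) <= D) ->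
    let Sp := global_step A s m1 alpha beta p in
    (forall i, dist (Sp i) (Sp (i + 1)) <= gamma * D) /\
    (forall i j, j = i * 2 \/ j = i * 2 + 1 -> dist (p i) (Sp j) <= C * D)].
Proof.
move=> m1_ge1 alpha0 b0 nOmega.
have m11 : (1 <= 1 <= m1)%N by rewrite m1_ge1.
have muP := linear_rate_bounds (alpha0 _ m11).
have contr := pyramid_contraction muP b0 nOmega.
set mu := linear_rate (alpha 1%N) in muP contr *.
have /andP[mu2 mu_lt1] := muP.
have Dn0 := pyramid_denom_gt0 b0; have m0 := modulus_gt0 b0.
have xm := le_lt_trans (ler_norm _) (normr_Re_lt_modulus b0).
pose N := 1 + (4 * modulus beta - 2 * complex.Re beta) + modulus beta ^+ 2.
have N0 : 0 <= N by rewrite /N addr_ge0 ?sqr_ge0//; lra.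
pose B := (`|pyramid_r beta| + 1)
  * (`|1 - pyramid_t2 beta| + `|pyramid_t1 beta|) + 1.
have B0 : 0 <= B by rewrite /B addr_ge0// mulr_ge0 ?addr_ge0.
(* The displacement constant adds the pyramid, the m1 linear rounds, and the index offset between i
   and (j + s - 1) / 2, which is at most |s| + 1. *)
exists (N / pyramid_denom beta * mu), (B * mu + m1%:R + (`|s|%N.+1)%:R).
split.
- have mu0 : 0 <= mu by lra.
  rewrite !mulr_ge0 ?invr_ge0 ?(ltW Dn0)//=.
  by rewrite mulrAC ltr_pdivrMr// mul1r [N * mu]mulrC contr.
- have Bmu : 0 <= B * mu by apply: mulr_ge0 => //; lra.
  by rewrite addr_ge0// addr_ge0.
move=> p D wd pD.
have D0 : 0 <= D := le_trans (dist_ge0 _ _) (pD 0).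
have qD i : dist (linear_rounds A alpha p m1 i)
    (linear_rounds A alpha p m1 (i + 1)) <= mu * D.
  by case: m1 m1_ge1 alpha0 {m11} wd => // m1 _ alpha0 wd;
     exact: (dist_linear_rounds M_connected alpha0 wd pD (ltnSn m1)).
have add2 (i : int) : i + 2 = i + 1 + 1 by rewrite -addrA.
have qD1 i : dist (linear_rounds A alpha p m1 (i + 1))
    (linear_rounds A alpha p m1 (i + 2)) <= mu * D by rewrite add2.
split=> [i|i j ij].
  rewrite /global_step (_ : i + 1 + s - 1 = i + s - 1 + 1); last by ring.
  set k := i + s - 1.
  rewrite -mulrA; have wdk := wd.2 k; have wdk1 := wd.2 (k + 1).
  rewrite add2 in wdk; rewrite !add2 in wdk1 *.
  by apply: dist_pyramid.
rewrite /global_step; set k := j + s - 1.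
apply: le_trans (dist_triangle M_connected (p (k %/ 2)%Z) _ _) _.
have pp : dist (p i) (p (k %/ 2)%Z) <= (`|s|%N.+1)%:R * D.
  apply: le_trans (dist_chain M_connected pD _ _) _.
  rewrite ler_wpM2r// ler_nat /k; case: ij => ->; lia.
have pq := dist_linear_rounds0 M_connected alpha0 wd pD (leqnn m1) k.
have qP := dist_pyramid0 M_connected (wd.2 k) (qD k) (qD1 k).
rewrite -/B in qP.
apply: le_trans (lerD (lexx _) (dist_triangle M_connected
  (linear_rounds A alpha p m1 k) _ _)) _.
rewrite dist_sym in pq; rewrite dist_sym in qP.
apply: le_trans (lerD pp (lerD pq qP)) _.
by rewrite le_eqVlt; apply/orP; left; apply/eqP; ring.
Qed.

(** * Uniform limits under geometric decay *)

Lemma geometric_cauchy (R : realType) (n : nat) (M : riemannian_manifold R n)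
    (M_connected : connected [set: M]) (u : nat -> M) (E gamma : R) :
  0 <= gamma < 1 ->
  (forall k, dist (u k) (u k.+1) <= E * gamma ^+ k) ->
  forall k l, (k <= l)%N -> dist (u k) (u l) <= E / (1 - gamma) * gamma ^+ k.
Proof.
move=> /andP[g0 g1] uE k l /subnKC <-.
have g1' : 0 < 1 - gamma by rewrite subr_gt0.
have E0 : 0 <= E by have := le_trans (dist_ge0 _ _) (uE 0%N); rewrite expr0 mulr1.
move: (l - k)%N => {}l; elim: l k => [|l IH] k.
  by rewrite addn0 dist_refl mulr_ge0 ?exprn_ge0// divr_ge0// ltW.
apply: le_trans (dist_triangle M_connected (u k.+1) _ _) _.
rewrite -addSnnS; apply: le_trans (lerD (uE k) (IH k.+1)) _.
(* The first step plus the geometric tail from k + 1 is exactly the tail from k. *)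
rewrite exprS le_eqVlt; apply/orP; left; apply/eqP; field.
by rewrite gt_eqF.
Qed.

Lemma geometric_small (R : realType) (C gamma e : R) :
  0 <= gamma < 1 -> 0 < e ->
  exists N, forall k, (N <= k)%N -> C * gamma ^+ k < e.
Proof.
move=> /andP[g0 g1] e0.
have := @cvg_geometric R C gamma _; rewrite ger0_norm// => /(_ g1).
move=> /cvgrPdist_lt/(_ _ e0)[N _ Nk]; exists N => k /Nk.
by rewrite /= sub0r normrN => /(le_lt_trans (ler_norm _)).
Qed.

Lemma geometric_uniform_limit (R : realType) (n : nat)
    (M : riemannian_manifold R n) (M_connected : connected [set: M])
    (M_complete : metrically_complete M) (T : Type) (u : nat -> T -> M)
    (E gamma : R) :
  0 <= gamma < 1 ->
  (forall k x, dist (u k x) (u k.+1 x) <= E * gamma ^+ k) ->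
  exists F : T -> M, forall e : R, 0 < e ->
    exists N, forall k, (N <= k)%N -> forall x, dist (u k x) (F x) < e.
Proof.
move=> g01 uE; pose C := E / (1 - gamma).
have uC x : forall k l, (k <= l)%N -> dist (u k x) (u l x) <= C * gamma ^+ k.
  by apply: geometric_cauchy => // k; exact: uE.
have lim x : exists y, forall e : R, 0 < e ->
    exists N, forall k, (N <= k)%N -> dist (u k x) y < e.
  apply: M_complete => e e0; have [N Ne] := geometric_small C g01 e0.
  exists N => k l Nk Nl; have [kl|/ltnW lk] := leqP k l.
    exact: le_lt_trans (uC x _ _ kl) (Ne _ Nk).
  by rewrite dist_sym; exact: le_lt_trans (uC x _ _ lk) (Ne _ Nl).
have [F FP] := choice lim; exists F => e e0.
have e20 : 0 < e / 2 by rewrite divr_gt0.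
have [N Ne] := geometric_small C g01 e20; exists N => k Nk x.
(* The auxiliary index may depend on [x]: it disappears from the estimate, and N was chosen before
   [x]. *)
have [L Le] := FP x _ e20; pose l := maxn k L.
apply: le_lt_trans (dist_triangle M_connected (u l x) _ _) _.
have ule := Le l (leq_maxr _ _).
have := uC x k l (leq_maxl _ _); have := Ne k Nk; lra.
Qed.

(** Used to see that the grid cell of a point at level k + 1 is one of the halves of its cell at
    level k. *)
Lemma floor_double (R : realType) (y : R) :
  Num.floor (y * 2) = Num.floor y * 2 \/ Num.floor (y * 2) = Num.floor y * 2 + 1.
Proof.
have := floor_itv y; set f := Num.floor y; rewrite intrD => /andP[fy yf].
have [y2|y2] := ltP (y * 2) (f%:~R * 2 + 1); [left|right].
  by apply: floor_def; rewrite !intrD intrM; apply/andP; split; lra.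
by apply: floor_def; rewrite !intrD intrM; apply/andP; split; lra.
Qed.

Theorem theorem4p10 (R : realType) (n : nat) (M : riemannian_manifold R n)
    (M_connected : connected [set: M]) (M_complete : metrically_complete M)
    (A : geodesic_averages M)
    (s : int) (m1 : nat) (m1_ge1 : (1 <= m1)%N)
    (alpha : nat -> R)
    (alpha_gt0 : forall i : nat, (1 <= i <= m1)%N -> 0 < alpha i)
    (beta : R[i]) (beta_nonreal : complex.Im beta != 0)
    (a : int -> R) (S : (int -> R) -> (int -> R)) (S_linear : linear_scheme a S)
    (S_symbol : forall z : R[i], z != 0 ->
       symbol a z = factored_symbol s m1 alpha beta z)
    (alpha1_min : linear_rate (alpha 1%N) = mu1 m1 alpha)
    (beta_outside : ~ Omega (mu1 m1 alpha) beta)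
    (p : int -> M) (p_admissible : admissible A p)
    (p_well_defined : refinement_well_defined A s m1 alpha beta p) :
  converges_from A s m1 alpha beta p.
Proof.
(* The contraction is that of the first linear round, whose rate is the minimum by the numbering of
   the factors. *)
rewrite -alpha1_min in beta_outside.
have [gamma [C [gamma01 C0 step]]] :=
  global_step_bounds M_connected A s m1_ge1 alpha_gt0 beta_nonreal beta_outside.
have [D pD] : exists D : R, forall i, dist (p i) (p (i + 1)) <= D.
  have [_ dp] := p_admissible.
  have le_dp i : ((dist (p i) (p (i + 1)))%:E <= delta p)%E.
    by apply: ereal_sup_ubound; exists i.
  exists (fine (delta p)) => i; rewrite -lee_fin fineK// fin_numElt dp andbT.
  exact: lt_le_trans (ltNyr _) (le_dp i).
have D0 : 0 <= D := le_trans (dist_ge0 _ _) (pD 0).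
have /andP[g0 g1] := gamma01.
pose pk := refined A s m1 alpha beta p.
have pkD k i : dist (pk k i) (pk k (i + 1)) <= gamma ^+ k * D.
  elim: k i => [|k IH] i; first by rewrite expr0 mul1r.
  by rewrite exprS -mulrA; apply: (proj1 (step _ _ (p_well_defined k) IH)).
have pkC k i j : j = i * 2 \/ j = i * 2 + 1 ->
    dist (pk k i) (pk k.+1 j) <= C * (gamma ^+ k * D).
  exact: (proj2 (step _ _ (p_well_defined k) (pkD k))).
(* At every level this is read off the first linear round at the odd index 2i + 1, where the doubled
   sequence passes from the i-th to the next point. *)
have joined k i : joinable A (pk k i) (pk k (i + 1)).
  have [] := (p_well_defined k).1 1%N (i * 2 + 1); first by rewrite m1_ge1.
  rewrite /= (_ : ((i * 2 + 1) %/ 2)%Z = i); last by lia.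
  by rewrite (_ : ((i * 2 + 1 + 1) %/ 2)%Z = i + 1); last by lia.
have interpD k x : dist (pk k (Num.floor (x * 2 ^+ k)))
    (interpolant A k (pk k) x) <= gamma ^+ k * D.
  rewrite /interpolant; set y := x * 2 ^+ k.
  apply: le_trans (dist_avg0 _ (joined _ _)) _.
  have y01 : `|y - (Num.floor y)%:~R| <= 1.
    rewrite ger0_norm ?subr_ge0 ?floor_le//.
    have := floorD1_gt y; rewrite intrD; lra.
  by rewrite -[leRHS]mul1r ler_pM ?normr_ge0 ?dist_ge0.
(* Successive interpolants at [x] are linked through the left nodes of the cells of [x] at both
   levels: C comes from the node displacement, 2 from the two moves within a cell. *)
apply: (@geometric_uniform_limit _ _ _ M_connected M_complete R
  (fun k x => interpolant A k (pk k) x) ((C + 2) * D) gamma) => // k x.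
set i := Num.floor (x * 2 ^+ k); set j := Num.floor (x * 2 ^+ k.+1).
have ij : j = i * 2 \/ j = i * 2 + 1.
  by rewrite /j exprSr mulrA; exact: floor_double.
have d1 := interpD k x; have d2 := interpD k.+1 x; have d3 := pkC k i j ij.
rewrite dist_sym -/i in d1; rewrite -/j in d2.
apply: le_trans (dist_triangle M_connected (pk k i) _ _) _.
apply: le_trans (lerD (lexx _) (dist_triangle M_connected (pk k.+1 j) _ _)) _.
apply: le_trans (lerD d1 (lerD d3 d2)) _.
have : gamma ^+ k.+1 * D <= gamma ^+ k * D.
  by rewrite ler_wpM2r// exprS ler_piMl ?exprn_ge0// ltW.
lra.
Qed.
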